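(* Let $\Gamma_W=\langle a,b\mid aba^{-3}b^2a^{-1}b^{-1}a^3b^{-2}\rangle$ and let $\rho_W:\Gamma_W\to\mathrm{SU}(2,1)\subset\mathrm{Sp}(2,1)$ be the representation defined by $$\rho_W(a)=\begin{pmatrix}1&\frac{\sqrt3-i\sqrt5}{2}&-1\\ \frac{-\sqrt3-i\sqrt5}{2}&-1&0\\-1&0&0\end{pmatrix},\qquad \rho_W(b)=\begin{pmatrix}1&-\frac{\sqrt3+i\sqrt5}{2}&-1\\ \frac{\sqrt3-i\sqrt5}{2}&-1&0\\-1&0&0\end{pmatrix}.$$ Then there are small deformations of $\rho_W:\Gamma_W\to\mathrm{Sp}(2,1)$ which are not conjugate to any representation $\Gamma_W\to\mathrm{U}(2,1)$; that is, every neighbourhood of $\rho_W$ in $\mathrm{Hom}(\Gamma_W,\mathrm{Sp}(2,1))$ contains a representation $\rho$ such that for no $g\in\mathrm{Sp}(2,1)$ is $g\rho(\Gamma_W)g^{-1}$ contained in $\mathrm{U}(2,1)$.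
   Context: Let $J=\begin{pmatrix}0&0&1\\0&1&0\\1&0&0\end{pmatrix}$, which has signature $(2,1)$. $\mathrm{U}(2,1)=\{g\in \mathrm{GL}(3,\mathbb{C}) : g^*Jg=J\}$, $\mathrm{SU}(2,1)$ is its subgroup of determinant-one elements, and $\mathrm{Sp}(2,1)=\{g\in\mathrm{GL}(3,\mathbb{H}): g^*Jg=J\}$, where $\mathbb{H}$ denotes the quaternions and $g^*$ the conjugate transpose; the inclusion $\mathbb{C}\subset\mathbb{H}$ gives $\mathrm{SU}(2,1)\subset\mathrm{U}(2,1)\subset\mathrm{Sp}(2,1)$. $\Gamma_W$ is the fundamental group of the Whitehead link complement. For $\Gamma$ generated by $n$ elements, $\mathrm{Hom}(\Gamma,G)\subset G^n$ (via the images of the generators) carries the subspace topology. *)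

(* Defs.v *)
From HB Require Import structures.
From mathcomp Require Import all_boot all_order all_algebra generic_quotient.
From mathcomp Require Import complex ring.
From mathcomp Require Import all_classical all_reals all_analysis.

Set Implicit Arguments.
Unset Strict Implicit.
Unset Printing Implicit Defensive.

Import Order.TTheory GRing.Theory Num.Theory.
Import numFieldNormedType.Exports.

Local Open Scope quotient_scope.
Local Open Scope ring_scope.

(* The letter (x, true) stands for x and (x, false) for its inverse. *)

Section Presentation.
Variables (X : choiceType) (rels : seq (seq (X * bool))).
Local Notation word := (seq (X * bool)).

Inductive pres_rel : word -> word -> Prop :=
| pres_refl w : pres_rel w w
| pres_sym v w : pres_rel v w -> pres_rel w v
| pres_trans u v w : pres_rel u v -> pres_rel v w -> pres_rel u w
| pres_cancel u v x e : pres_rel (u ++ [:: (x, e), (x, ~~ e) & v]) (u ++ v)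
| pres_relator u v r : r \in rels -> pres_rel (u ++ r ++ v) (u ++ v).

Definition pres_relb : rel word := fun v w => `[< pres_rel v w >].

Lemma pres_relb_refl : reflexive pres_relb.
Proof. by move=> w; apply/asboolP; exact: pres_refl. Qed.

Lemma pres_relb_sym : symmetric pres_relb.
Proof. by move=> v w; apply/asboolP/asboolP; exact: pres_sym. Qed.

Lemma pres_relb_trans : transitive pres_relb.
Proof.
by move=> v u w /asboolP uv /asboolP vw; apply/asboolP/(pres_trans uv).
Qed.

Canonical pres_equiv :=
  EquivRel pres_relb pres_relb_refl pres_relb_sym pres_relb_trans.

Definition presented := {eq_quot pres_equiv}.
HB.instance Definition _ := Choice.on presented.
HB.instance Definition _ := EqQuotient.on presented.

Lemma presW (P : presented -> Type) :
  (forall w, P (\pi_presented w)) -> forall p, P p.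
Proof. by move=> Pw p; rewrite -[p]reprK. Qed.

Lemma presP v w : pres_rel v w <-> \pi_presented v = \pi_presented w.
Proof.
split=> [vw|/eqmodP/asboolP//]; by apply/eqmodP/asboolP.
Qed.

Lemma pres_ctx u v w w' : pres_rel w w' -> pres_rel (u ++ w ++ v) (u ++ w' ++ v).
Proof.
elim=> [?|? ? _|? ? ? _ IH1 _|a b x e|a b r rin].
- exact: pres_refl.
- exact: pres_sym.
- exact: pres_trans.
- by rewrite -!catA /= !(catA u a); exact: pres_cancel.
- by rewrite -!catA !(catA u a); exact: pres_relator.
Qed.

Definition inv_word (w : word) : word := rev [seq (l.1, ~~ l.2) | l <- w].

Lemma inv_word_cat v w : inv_word (v ++ w) = inv_word w ++ inv_word v.
Proof. by rewrite /inv_word map_cat rev_cat. Qed.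

Lemma inv_wordK : involutive inv_word.
Proof.
move=> w; rewrite /inv_word map_rev revK -map_comp -[RHS]map_id.
by apply: eq_map => -[x e] /=; rewrite negbK.
Qed.

Lemma mul_inv_word w : pres_rel (w ++ inv_word w) [::].
Proof.
elim: w => [|[x e] w IH]; first exact: pres_refl.
rewrite -cat1s inv_word_cat -catA (catA w) /inv_word /=.
apply: pres_trans (pres_ctx [:: (x, e)] [:: (x, ~~ e)] IH) _.
exact: (pres_cancel [::] [::]).
Qed.

Lemma mul_inv_word' w : pres_rel (inv_word w ++ w) [::].
Proof. by have := mul_inv_word (inv_word w); rewrite inv_wordK. Qed.

Lemma pres_rel_inv v w : pres_rel v w -> pres_rel (inv_word v) (inv_word w).
Proof.
move=> vw.
have h1 : pres_rel (inv_word v ++ w ++ inv_word w) (inv_word v).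
  by have := pres_ctx (inv_word v) [::] (mul_inv_word w); rewrite !cats0.
have h2 : pres_rel (inv_word v ++ w ++ inv_word w) (inv_word w).
  apply: pres_trans (pres_ctx (inv_word v) (inv_word w) (pres_sym vw)) _.
  by rewrite catA; exact: (pres_ctx [::] (inv_word w) (mul_inv_word' v)).
exact: pres_trans (pres_sym h1) h2.
Qed.

Definition pres_mul (p q : presented) : presented := \pi_presented (repr p ++ repr q).
Definition pres_inv (p : presented) : presented := \pi_presented (inv_word (repr p)).
Definition pres_one : presented := \pi_presented [::].

Lemma pres_repr w : pres_rel (repr (\pi_presented w)) w.
Proof. by apply/presP; rewrite reprK. Qed.

Lemma pres_mulE v w : pres_mul (\pi_presented v) (\pi_presented w) = \pi_presented (v ++ w).
Proof.
apply/presP; apply: pres_trans (pres_ctx [::] _ (pres_repr v)) _.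
by have := pres_ctx v [::] (pres_repr w); rewrite !cats0.
Qed.

Lemma pres_invE w : pres_inv (\pi_presented w) = \pi_presented (inv_word w).
Proof. exact/presP/pres_rel_inv/pres_repr. Qed.

Lemma pres_mulA : associative pres_mul.
Proof. by elim/presW=> u; elim/presW=> v; elim/presW=> w; rewrite !pres_mulE catA. Qed.

Lemma pres_mul1 : left_id pres_one pres_mul.
Proof. by elim/presW=> w; rewrite pres_mulE. Qed.

Lemma pres_mulr1 : right_id pres_one pres_mul.
Proof. by elim/presW=> w; rewrite pres_mulE cats0. Qed.

Lemma pres_mulV : left_inverse pres_one pres_inv pres_mul.
Proof.
elim/presW=> w; rewrite pres_invE pres_mulE; exact/presP/mul_inv_word'.
Qed.

Lemma pres_mulrV : right_inverse pres_one pres_inv pres_mul.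
Proof.
elim/presW=> w; rewrite pres_invE pres_mulE; exact/presP/mul_inv_word.
Qed.

HB.instance Definition _ := isGroup.Build presented
  pres_mulA pres_mul1 pres_mulr1 pres_mulV pres_mulrV.

Definition pres_gen (x : X) : presented := \pi_presented [:: (x, true)].

Section Lift.
Variables (G : groupType) (f : X -> G).

Definition letter_val (l : X * bool) : G := if l.2 then f l.1 else (f l.1)^-1%g.
Definition word_val (w : word) : G := (\prod_(l <- w) letter_val l)%g.

Hypothesis relsP : {in rels, forall r, word_val r = 1%g}.

Lemma word_val_cat v w : word_val (v ++ w) = (word_val v * word_val w)%g.
Proof. exact: big_cat. Qed.

Lemma word_val_rel v w : pres_rel v w -> word_val v = word_val w.
Proof.
elim=> [//|//|? ? ? _ -> _ -> //|a b x e|a b r rin].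
  rewrite !word_val_cat /word_val !big_cons mulgA /letter_val /=.
  by case: e => /=; rewrite ?mulgV ?mulVg ?mulgA ?mulgK ?mulgVK.
by rewrite !word_val_cat (relsP rin) mul1g.
Qed.

Definition pres_lift (p : presented) : G := word_val (repr p).

Lemma pres_liftE w : pres_lift (\pi_presented w) = word_val w.
Proof. exact/word_val_rel/pres_repr. Qed.

Lemma pres_liftM : {morph pres_lift : p q / (p * q)%g}.
Proof.
elim/presW=> v; elim/presW=> w.
by rewrite [(_ * _)%g in LHS]pres_mulE !pres_liftE word_val_cat.
Qed.

Lemma pres_lift1 : pres_lift 1%g = 1%g.
Proof. by rewrite pres_liftE /word_val big_nil. Qed.

Lemma pres_lift_gen x : pres_lift (pres_gen x) = f x.
Proof. by rewrite pres_liftE /word_val big_seq1. Qed.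

Definition pres_hom : UMagmaMorphism.type presented G :=
  HB.pack pres_lift
    (isUMagmaMorphism.Build presented G pres_lift (pres_lift1, pres_liftM)).

End Lift.
End Presentation.

HB.mixin Record isStarRing A of GRing.NzRing A := {
  star : A -> A;
  starD : {morph star : x y / x + y};
  starM : forall x y, star (x * y) = star y * star x;
  starK : involutive star
}.

#[short(type="starRingType")]
HB.structure Definition StarRing := {A of isStarRing A & GRing.NzRing A}.

Section StarTheory.
Variable A : starRingType.

Lemma star0 : star (0 : A) = 0.
Proof. by apply: (@addrI _ (star 0)); rewrite -starD !addr0. Qed.

Lemma star1 : star (1 : A) = 1.
Proof. by rewrite -[LHS]mulr1 -[X in _ * X]starK -starM mulr1 starK. Qed.

Lemma star_sum I (r : seq I) (F : I -> A) :
  star (\sum_(i <- r) F i) = \sum_(i <- r) star (F i).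
Proof. exact: (big_morph _ (@starD A) star0). Qed.

Definition adjmx m n (M : 'M[A]_(m, n)) : 'M[A]_(n, m) :=
  \matrix_(i, j) star (M j i).

Lemma adjmxM m n p (M : 'M[A]_(m, n)) (N : 'M[A]_(n, p)) :
  adjmx (M *m N) = adjmx N *m adjmx M.
Proof.
apply/matrixP => i j; rewrite !mxE star_sum; apply: eq_bigr => k _.
by rewrite starM !mxE.
Qed.

Lemma adjmxK m n (M : 'M[A]_(m, n)) : adjmx (adjmx M) = M.
Proof. by apply/matrixP => i j; rewrite !mxE starK. Qed.

Lemma adjmx1 n : adjmx (1%:M : 'M[A]_n) = 1%:M.
Proof.
apply/matrixP => i j; rewrite !mxE eq_sym.
by case: (i == j); rewrite ?star1 ?star0.
Qed.

Definition J21 : 'M[A]_3 := \matrix_(i, j) (i + j == 2)%N%:R.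

Lemma adjJ21 : adjmx J21 = J21.
Proof.
apply/matrixP => i j; rewrite !mxE addnC.
by case: eqP; rewrite ?star1 ?star0.
Qed.

Lemma J21K : J21 *m J21 = 1%:M.
Proof.
apply/matrixP => i j; rewrite !mxE !big_ord_recl big_ord0 !mxE.
case: i => -[|[|[|i]]] //= ?; case: j => -[|[|[|j]]] //= ?;
  by rewrite ?(mul0r, mulr0, mul1r, mulr1, add0r, addr0).
Qed.

Definition in_GL n (g : 'M[A]_n) : Prop :=
  exists h, g *m h = 1%:M /\ h *m g = 1%:M.

Definition preserves_J21 : {pred 'M[A]_3} :=
  fun g => `[< in_GL g /\ adjmx g *m J21 *m g = J21 >].

Record U21_of := U21_Of {
  U21_val :> 'M[A]_3;
  U21_valP : preserves_J21 U21_val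
}.

HB.instance Definition _ := [isSub for U21_val].
HB.instance Definition _ := [Choice of U21_of by <:].

Definition U21_adj (g : 'M[A]_3) := J21 *m adjmx g *m J21.

Lemma U21_adjV g : preserves_J21 g -> U21_adj g *m g = 1%:M.
Proof.
by move=> /asboolP[_ gJ]; rewrite /U21_adj -!mulmxA (mulmxA (adjmx g)) gJ J21K.
Qed.

Lemma U21_adjVr g : preserves_J21 g -> g *m U21_adj g = 1%:M.
Proof.
move=> Pg; have /asboolP[[h [gh _]] _] := Pg.
suff -> : U21_adj g = h by [].
by rewrite -[LHS]mulmx1 -gh mulmxA U21_adjV// mul1mx.
Qed.

Lemma preserves_J21_1 : preserves_J21 1%:M.
Proof.
apply/asboolP; split; last by rewrite adjmx1 mul1mx mulmx1.
by exists 1%:M; rewrite mulmx1.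
Qed.

Lemma preserves_J21_M g h :
  preserves_J21 g -> preserves_J21 h -> preserves_J21 (g *m h).
Proof.
move=> Pg Ph; apply/asboolP; split.
  exists (U21_adj h *m U21_adj g); split.
    by rewrite mulmxA -(mulmxA g) U21_adjVr// mulmx1 U21_adjVr.
  by rewrite mulmxA -(mulmxA (U21_adj h)) U21_adjV// mulmx1 U21_adjV.
have /asboolP[_ gJ] := Pg; have /asboolP[_ hJ] := Ph.
by rewrite adjmxM -!mulmxA (mulmxA J21) (mulmxA (adjmx g)) (mulmxA (adjmx g)) gJ mulmxA.
Qed.

Lemma preserves_J21_V g : preserves_J21 g -> preserves_J21 (U21_adj g).
Proof.
move=> Pg; apply/asboolP; split.
  by exists g; rewrite U21_adjV// U21_adjVr.
rewrite {1}/U21_adj !adjmxM adjmxK adjJ21.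
transitivity (J21 *m (g *m U21_adj g)); last by rewrite U21_adjVr// mulmx1.
by rewrite !mulmxA -(mulmxA (J21 *m g)) J21K mulmx1.
Qed.

Definition U21_one := U21_Of preserves_J21_1.
Definition U21_mul (g h : U21_of) :=
  U21_Of (preserves_J21_M (U21_valP g) (U21_valP h)).
Definition U21_inv (g : U21_of) := U21_Of (preserves_J21_V (U21_valP g)).

Lemma U21_mulA : associative U21_mul.
Proof. by move=> g h k; apply: val_inj; exact: mulmxA. Qed.
Lemma U21_mul1 : left_id U21_one U21_mul.
Proof. by move=> g; apply: val_inj; exact: mul1mx. Qed.
Lemma U21_mulr1 : right_id U21_one U21_mul.
Proof. by move=> g; apply: val_inj; exact: mulmx1. Qed.
Lemma U21_mulV : left_inverse U21_one U21_inv U21_mul.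
Proof. by move=> g; apply: val_inj; exact/U21_adjV/U21_valP. Qed.
Lemma U21_mulrV : right_inverse U21_one U21_inv U21_mul.
Proof. by move=> g; apply: val_inj; exact/U21_adjVr/U21_valP. Qed.

HB.instance Definition _ := isGroup.Build U21_of
  U21_mulA U21_mul1 U21_mulr1 U21_mulV U21_mulrV.

End StarTheory.

Arguments J21 {A}.

(* Quat a b c d = a + b i + c j + d k. *)

Record quat (R : Type) := Quat { qre : R; qi : R; qj : R; qk : R }.

Definition quat_coords R (q : quat R) := (qre q, qi q, qj q, qk q).
Definition coords_quat R (c : R * R * R * R) : quat R :=
  let: (a, b, c, d) := c in Quat a b c d.
Lemma quat_coordsK R : cancel (@quat_coords R) (@coords_quat R).
Proof. by case. Qed.

HB.instance Definition _ (R : eqType) :=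
  Equality.copy (quat R) (can_type (@quat_coordsK R)).
HB.instance Definition _ (R : choiceType) :=
  Choice.copy (quat R) (can_type (@quat_coordsK R)).

Section QuatRing.
Variable R : realType.
Local Notation H := (quat R).
Implicit Types p q : H.

Definition quat_add p q := Quat (qre p + qre q) (qi p + qi q)
  (qj p + qj q) (qk p + qk q).
Definition quat_opp q := Quat (- qre q) (- qi q) (- qj q) (- qk q).
Definition quat_mul p q := Quat
  (qre p * qre q - qi p * qi q - qj p * qj q - qk p * qk q)
  (qre p * qi q + qi p * qre q + qj p * qk q - qk p * qj q)
  (qre p * qj q - qi p * qk q + qj p * qre q + qk p * qi q)
  (qre p * qk q + qi p * qj q - qj p * qi q + qk p * qre q).
Definition quat_conj q := Quat (qre q) (- qi q) (- qj q) (- qk q).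

Lemma quat_addA : associative quat_add.
Proof. by move=> p q r; rewrite /quat_add /=; congr Quat; ring. Qed.
Lemma quat_addC : commutative quat_add.
Proof. by move=> p q; rewrite /quat_add /=; congr Quat; ring. Qed.
Lemma quat_add0 : left_id (Quat 0 0 0 0) quat_add.
Proof. by case=> a b c d; rewrite /quat_add /=; congr Quat; ring. Qed.
Lemma quat_addN : left_inverse (Quat 0 0 0 0) quat_opp quat_add.
Proof. by move=> p; rewrite /quat_add /quat_opp /=; congr Quat; ring. Qed.

HB.instance Definition _ :=
  GRing.isZmodule.Build H quat_addA quat_addC quat_add0 quat_addN.

Lemma quat_mulA : associative quat_mul.
Proof. by move=> p q r; rewrite /quat_mul /=; congr Quat; ring. Qed.
Lemma quat_mul1 : left_id (Quat 1 0 0 0) quat_mul.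
Proof. by case=> a b c d; rewrite /quat_mul /=; congr Quat; ring. Qed.
Lemma quat_mulr1 : right_id (Quat 1 0 0 0) quat_mul.
Proof. by case=> a b c d; rewrite /quat_mul /=; congr Quat; ring. Qed.
Lemma quat_mulDl : left_distributive quat_mul quat_add.
Proof. by move=> p q r; rewrite /quat_mul /quat_add /=; congr Quat; ring. Qed.
Lemma quat_mulDr : right_distributive quat_mul quat_add.
Proof. by move=> p q r; rewrite /quat_mul /quat_add /=; congr Quat; ring. Qed.
Lemma quat_1_neq0 : Quat 1 0 0 0 != 0 :> H.
Proof. by apply/eqP => -[] /eqP; rewrite oner_eq0. Qed.

HB.instance Definition _ := GRing.Zmodule_isNzRing.Build H
  quat_mulA quat_mul1 quat_mulr1 quat_mulDl quat_mulDr quat_1_neq0.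

Lemma quat_conjD : {morph quat_conj : p q / quat_add p q}.
Proof. by move=> p q; rewrite /quat_conj /quat_add /=; congr Quat; ring. Qed.
Lemma quat_conjM p q :
  quat_conj (quat_mul p q) = quat_mul (quat_conj q) (quat_conj p).
Proof. by rewrite /quat_conj /quat_mul /=; congr Quat; ring. Qed.
Lemma quat_conjK : involutive quat_conj.
Proof. by case=> a b c d; rewrite /quat_conj /= !opprK. Qed.

HB.instance Definition _ := isStarRing.Build H quat_conjD quat_conjM quat_conjK.

HB.instance Definition _ :=
  Topological.copy H (initial_topology (@quat_coords R)).

End QuatRing.

Section ComplexStar.
Variable R : realType.
Local Notation C := (R[i]).

Lemma conjcM_rev (x y : R[i]) : conjc (x * y) = conjc y * conjc x.
Proof. by rewrite mulrC rmorphM. Qed.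

HB.instance Definition _ := isStarRing.Build R[i]
  (@rmorphD _ _ (@conjc R)) conjcM_rev (@conjcK R).

Definition complex_quat (z : R[i]) : quat R := Quat (complex.Re z) (complex.Im z) 0 0.

Lemma complex_quatD : {morph complex_quat : x y / x + y}.
Proof.
move=> [a b] [c d]; rewrite -[RHS]/(quat_add _ _) /quat_add /complex_quat /=.
by rewrite !addr0.
Qed.

Lemma complex_quatM : {morph complex_quat : x y / x * y}.
Proof.
move=> [a b] [c d]; rewrite -[RHS]/(quat_mul _ _) /quat_mul /complex_quat /=.
by congr Quat; ring.
Qed.

Lemma complex_quat_star x : complex_quat (star x) = star (complex_quat x).
Proof. by case: x => a b; rewrite /star /= /complex_quat /quat_conj /= oppr0. Qed.

Definition quatmx n (M : 'M[C]_n) : 'M[quat R]_n := map_mx complex_quat M.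

Lemma quatmxM n (M N : 'M[C]_n) : quatmx (M *m N) = quatmx M *m quatmx N.
Proof.
apply/matrixP => i j; rewrite !mxE (big_morph _ complex_quatD (erefl _)).
by apply: eq_bigr => k _; rewrite complex_quatM !mxE.
Qed.

Lemma quatmx1 n : quatmx (1%:M : 'M[C]_n) = 1%:M.
Proof. by apply/matrixP => i j; rewrite !mxE; case: (i == j). Qed.

Lemma quatmxJ : quatmx J21 = J21.
Proof. by apply/matrixP => i j; rewrite !mxE; case: (_ == _). Qed.

Lemma quatmx_adj n (M : 'M[C]_n) : quatmx (adjmx M) = adjmx (quatmx M).
Proof. by apply/matrixP => i j; rewrite !mxE complex_quat_star. Qed.

Lemma quatmx_preserves_J21 g :
  preserves_J21 g -> preserves_J21 (quatmx g).
Proof.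
move=> /asboolP[[h [gh hg]] gJ]; apply/asboolP; split.
  by exists (quatmx h); rewrite -!quatmxM gh hg quatmx1.
by rewrite -quatmx_adj -quatmxJ -!quatmxM gJ.
Qed.

End ComplexStar.

Definition U21 (R : realType) := U21_of R[i].
HB.instance Definition _ R := Group.on (U21 R).

Definition Sp21 (R : realType) := U21_of (quat R).
HB.instance Definition _ R := Group.on (Sp21 R).
HB.instance Definition _ (R : realType) :=
  Topological.copy (Sp21 R) (initial_topology (@U21_val (quat R))).

Section Groups.
Variable R : realType.

Definition det_one : {pred U21 R} := fun g => \det (U21_val g) == 1.

Lemma det_one_closed : group_closed det_one.
Proof.
split; first by rewrite unfold_in /det_one det1.
move=> g h; rewrite !unfold_in => /eqP dg /eqP dh.
have := congr1 (fun x : U21 R => \det (U21_val x)) (divgK h g).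
by rewrite /= det_mulmx dg dh mulr1 => ->.
Qed.

Record SU21 := SU21_Of { SU21_val :> U21 R; SU21_valP : det_one SU21_val }.
HB.instance Definition _ := [isSub for SU21_val].
HB.instance Definition _ := [Choice of SU21 by <:].
HB.instance Definition _ := SubChoice_isSubGroup.Build _ _ SU21 det_one_closed.

Definition Sp_of_U (g : U21 R) : Sp21 R :=
  U21_Of (quatmx_preserves_J21 (U21_valP g)).

Lemma Sp_of_U1 : Sp_of_U 1%g = 1%g.
Proof. by apply: val_inj; exact: quatmx1. Qed.
Lemma Sp_of_UM : {morph Sp_of_U : g h / (g * h)%g}.
Proof. by move=> g h; apply: val_inj; exact: quatmxM. Qed.
HB.instance Definition _ :=
  isUMagmaMorphism.Build (U21 R) (Sp21 R) Sp_of_U (Sp_of_U1, Sp_of_UM).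

End Groups.

(* a b a^-3 b^2 a^-1 b^-1 a^3 b^-2, with a, b the letters 0, 1 *)
Definition relator_W : seq ('I_2 * bool) :=
  let a : 'I_2 := ord0 in let b : 'I_2 := ord_max in
  [:: (a, true); (b, true)] ++ nseq 3 (a, false) ++ nseq 2 (b, true) ++
  [:: (a, false); (b, false)] ++ nseq 3 (a, true) ++ nseq 2 (b, false).

Definition Gamma_W := presented [:: relator_W].
HB.instance Definition _ := Group.on Gamma_W.

Definition gen_a : Gamma_W := pres_gen _ ord0.
Definition gen_b : Gamma_W := pres_gen _ ord_max.

Definition Hom_W (G : groupType) := UMagmaMorphism.type Gamma_W G.

Definition gen_images (G : groupType) (rho : Hom_W G) : G * G :=
  (rho gen_a, rho gen_b).

HB.instance Definition _ (G : groupType) := gen_eqMixin (Hom_W G).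
HB.instance Definition _ (G : groupType) := gen_choiceMixin (Hom_W G).

Definition Hom_W_Sp (R : realType) := Hom_W (Sp21 R).
HB.instance Definition _ (R : realType) := Choice.on (Hom_W_Sp R).
HB.instance Definition _ (R : realType) := Topological.copy (Hom_W_Sp R)
  (initial_topology (@gen_images (Sp21 R) : Hom_W_Sp R -> Sp21 R * Sp21 R)).

Section RhoW.
Variable R : realType.
Local Notation C := (R[i]).

Definition mx3 (s : seq (seq C)) : 'M[C]_3 :=
  \matrix_(i, j) nth 0 (nth [::] s i) j.

Definition sqrt3 : C := (Num.sqrt 3)%:C%C.
Definition sqrt5 : C := (Num.sqrt 5)%:C%C.
Definition imI : C := Complex 0 1.

Definition mx_a := mx3
  [:: [:: 1; (sqrt3 - imI * sqrt5) / 2; -1];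
      [:: (- sqrt3 - imI * sqrt5) / 2; -1; 0];
      [:: -1; 0; 0]].

Definition mx_b := mx3
  [:: [:: 1; - ((sqrt3 + imI * sqrt5) / 2); -1];
      [:: (sqrt3 - imI * sqrt5) / 2; -1; 0];
      [:: -1; 0; 0]].

(* Both matrices have the following shape, with y the conjugate of x and
   x y = 2; such a matrix has order 3. *)
Let shape x y := mx3 [:: [:: 1; x; -1]; [:: - y; -1; 0]; [:: -1; 0; 0]].

Let three_ind (P : 'I_3 -> Prop) : P ord0 -> P (lift ord0 ord0) ->
  P (lift ord0 (lift ord0 ord0)) -> forall i, P i.
Proof.
move=> p0 p1 p2 [[|[|[|//]]] ?].
- by rewrite (_ : Ordinal _ = ord0)//; apply: val_inj.
- by rewrite (_ : Ordinal _ = lift ord0 ord0)//; apply: val_inj.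
- by rewrite (_ : Ordinal _ = lift ord0 (lift ord0 ord0))//; apply: val_inj.
Qed.

Let shape3 x y : x * y = 2 -> shape x y *m (shape x y *m shape x y) = 1%:M.
Proof.
move=> xy; have -> : shape x y *m shape x y = mx3
    [:: [:: 0; 0; -1]; [:: 0; -1; y]; [:: -1; - x; 1]].
  apply/matrixP; apply: three_ind; apply: three_ind;
    rewrite !mxE !big_ord_recl big_ord0 !mxE /=; ring: xy.
apply/matrixP; apply: three_ind; apply: three_ind;
  rewrite !mxE !big_ord_recl big_ord0 !mxE /=; ring: xy.
Qed.

Let shape_preserves x y : x * y = 2 -> star x = y -> preserves_J21 (shape x y).
Proof.
move=> xy sx; have sy : star y = x by rewrite -sx starK.
apply/asboolP; split.
  exists (shape x y *m shape x y); rewrite shape3// -mulmxA shape3//.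
have sN (z : C) : star (- z) = - star z.
  by apply: (@addrI _ (star z)); rewrite -starD !subrr star0.
apply/matrixP; apply: three_ind; apply: three_ind;
  rewrite !(mxE, big_ord_recl, big_ord0) /= ?sN ?sx ?sy ?star0 ?star1 ?mulr1n ?mulr0n; ring: xy.
Qed.

Let shape_det x y : \det (shape x y) = 1.
Proof.
rewrite (expand_det_row _ ord0) !big_ord_recl big_ord0 /cofactor.
rewrite !(expand_det_row _ (ord0 : 'I_2)) !big_ord_recl !big_ord0 /cofactor.
by rewrite !det_mx11 !mxE /=; ring.
Qed.

Let s3 : sqrt3 * sqrt3 = 3.
Proof. by rewrite /sqrt3 /sqrt5 -rmorphM -expr2 sqr_sqrtr ?ler0n// rmorph_nat. Qed.
Let s5 : sqrt5 * sqrt5 = 5.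
Proof. by rewrite /sqrt3 /sqrt5 -rmorphM -expr2 sqr_sqrtr ?ler0n// rmorph_nat. Qed.
Let im2 : imI * imI = -1.
Proof.
by rewrite -[LHS]/(Complex (0 * 0 - 1 * 1) (0 * 1 + 1 * 0)); apply/eqP; rewrite eq_complex /= !mul0r !mulr0 mulr1 !(sub0r, addr0) oppr0 !eqxx.
Qed.

Let x0 : C := (sqrt3 - imI * sqrt5) / 2.
Let y0 : C := (sqrt3 + imI * sqrt5) / 2.

Let xy0 : x0 * y0 = 2.
Proof.
have n2 : (2 : C) != 0 by rewrite pnatr_eq0.
have -> : x0 * y0 = (sqrt3 * sqrt3 - (imI * imI) * (sqrt5 * sqrt5)) / 4.
  by rewrite /x0 /y0; field.
by rewrite s3 s5 im2; field.
Qed.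

Let star_x0 : star x0 = y0.
Proof.
have sN (z : C) : star (- z) = - star z.
  by apply: (@addrI _ (star z)); rewrite -starD !subrr star0.
have im_star : star imI = - imI.
  by rewrite /imI -[LHS]/(Complex 0 (-1)) -[RHS]/(Complex (-0) (-1)) oppr0.
have half_star : star (2^-1 : C) = 2^-1.
  by rewrite -[LHS]/(conjc 2^-1) conjc_inv conjc_nat.
have s3_star : star sqrt3 = sqrt3 by exact: conjc_real.
have s5_star : star sqrt5 = sqrt5 by exact: conjc_real.
by rewrite /x0 /y0 starM starD sN starM half_star im_star s3_star s5_star; ring.
Qed.

Let mx_aE : mx_a = shape x0 y0.
Proof.
rewrite /mx_a (_ : (- sqrt3 - imI * sqrt5) / 2 = - y0)//.
by rewrite /y0; ring.
Qed.

Let mx_bE : mx_b = shape (- y0) (- x0).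
Proof. by rewrite /mx_b /shape /x0 /y0 opprK. Qed.

Let xy1 : - y0 * - x0 = 2. Proof. by rewrite mulrNN mulrC xy0. Qed.
Let star_y0 : star (- y0) = - x0.
Proof.
rewrite -[in LHS]star_x0; apply: (@addrI _ (star (star x0))).
by rewrite -starD subrr star0 starK subrr.
Qed.

Lemma mx_a_preserves_J21 : preserves_J21 mx_a.
Proof. by rewrite mx_aE; exact: shape_preserves. Qed.
Lemma mx_b_preserves_J21 : preserves_J21 mx_b.
Proof. by rewrite mx_bE; exact: shape_preserves. Qed.

Lemma mx_a_det : det_one (U21_Of mx_a_preserves_J21).
Proof. by rewrite /det_one /= mx_aE shape_det. Qed.
Lemma mx_b_det : det_one (U21_Of mx_b_preserves_J21).
Proof. by rewrite /det_one /= mx_bE shape_det. Qed.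

Definition SU_a : SU21 R := SU21_Of mx_a_det.
Definition SU_b : SU21 R := SU21_Of mx_b_det.

Let SU_a3 : (SU_a * (SU_a * SU_a) = 1)%g.
Proof.
by do 2 apply: val_inj; rewrite /= -[LHS]/(mx_a *m (mx_a *m mx_a)) mx_aE shape3.
Qed.
Let SU_b3 : (SU_b * (SU_b * SU_b) = 1)%g.
Proof.
by do 2 apply: val_inj; rewrite /= -[LHS]/(mx_b *m (mx_b *m mx_b)) mx_bE shape3.
Qed.

Definition SU_gen (x : 'I_2) : SU21 R := if x == ord0 then SU_a else SU_b.

Lemma relator_W_SU :
  {in [:: relator_W], forall r, word_val SU_gen r = 1%g}.
Proof.
move=> r; rewrite inE => /eqP ->.
rewrite /word_val /relator_W /= !big_cons big_nil /letter_val /=.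
rewrite /SU_gen /=.
have a3 : (SU_a^-1 * (SU_a^-1 * SU_a^-1) = 1)%g.
  by rewrite -!invgM -mulgA SU_a3 invg1.
have b2 : (SU_b * SU_b = SU_b^-1)%g.
  by apply: (@mulgI _ SU_b); rewrite SU_b3 mulgV.
have b2' : (SU_b^-1 * SU_b^-1 = SU_b)%g by rewrite -invgM b2 invgK.
rewrite mulg1 b2' !mulgA.
have -> : (SU_a * SU_b * SU_a^-1 * SU_a^-1 * SU_a^-1 = SU_a * SU_b)%g.
  by rewrite -[RHS]mulg1 -a3 !mulgA.
rewrite -[(_ * SU_b * SU_b)%g]mulgA b2.
rewrite mulgK mulgV mul1g.
have -> : (SU_b^-1 * SU_a * SU_a * SU_a = SU_b^-1)%g.
  by rewrite -[RHS]mulg1 -SU_a3 !mulgA.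
exact: mulVg.
Qed.

Definition rho_W : Hom_W (SU21 R) := pres_hom relator_W_SU.

Lemma rho_W_a : SU21_val (rho_W gen_a) = mx_a :> 'M[C]_3.
Proof. by rewrite /= pres_lift_gen//; exact: relator_W_SU. Qed.
Lemma rho_W_b : SU21_val (rho_W gen_b) = mx_b :> 'M[C]_3.
Proof. by rewrite /= pres_lift_gen//; exact: relator_W_SU. Qed.

Definition rho_W_Sp : Hom_W_Sp R :=
  (@Sp_of_U R \o (val : SU21 R -> U21 R) \o rho_W).

End RhoW.

(* Main.v *)
Require Import Defs.
From mathcomp Require Import all_boot all_order all_algebra.
From mathcomp Require Import complex ring lra.
From mathcomp Require Import all_classical all_reals all_analysis.

Set Implicit Arguments.
Unset Strict Implicit.
Unset Printing Implicit Defensive.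

Import Order.TTheory GRing.Theory Num.Theory.
Import numFieldNormedType.Exports.

Local Open Scope ring_scope.

(** Write [S x] for [order3 x]. It preserves the Hermitian form and has order 3
    for every quaternion [x] of squared norm 2, and
    [rho_W(a) = S x], [rho_W(b) = S (- star x)] with
    [x = (sqrt 3 - i sqrt 5) / 2]. The relator is a consequence of
    [a ^ 3 = b ^ 3 = 1] ([relator_W_order3]), so [rho_W] factors through the
    free product of two cyclic groups of order 3, and any element of order 3 may
    be substituted for [rho_W(b)]. The deformation keeps [rho_W(a)] and
    conjugates [rho_W(b)] by the unipotent matrix [heis (t j)] of [Sp(2,1)],
    with [t] real and small; it tends to [rho_W] as [t] tends to 0
    ([cvg_deformation]).

    If [g] conjugates a representation into [U(2,1)], its image commutes with
    [M = g^-1 i g], because complex matrices commute with the scalar [i]; and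
    [M ^ 2 = -1] ([conj_into_U21]). It therefore suffices that only the
    real scalars commute with [S x] and with
    [heis w S(- star x) heis (- w)], where [w = t j] and [t > 0] is small
    ([twisted_centralizer]).

    Let [M] commute with both, and let [(a, b, c)] be its last row. Commuting
    with [S x] expresses the first row of [M] through the last one
    ([order3_centralizer]). The conjugate [heis (- w) M heis w] commutes with
    [S (- star x)], so the same formulas hold for it, with last row
    [(a, b, c + a w)]. Comparing the two sets of formulas, and using that
    [r = x + star x] is real, gives
    [w b = - r a] and [r b = a w + w a]. Eliminating [b] yields
    [t ^ 2 (a - j a j) = r ^ 2 a], and the real-linear map [a |-> a - j a j] has
    eigenvalues 0 and 2; hence [a = b = 0] as soon as [2 t ^ 2] differs from
    [r ^ 2 = 3]. The remaining equations make [M] a scalar matrix [c] where [c]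
    commutes with [x] and with [w], hence with [i] and [j], so [c] is real. *)

Local Notation o0 := (ord0 : 'I_3).
Local Notation o1 := (lift ord0 ord0 : 'I_3).
Local Notation o2 := (lift ord0 (lift ord0 ord0) : 'I_3).

Lemma forall_I3 (P : 'I_3 -> Prop) : P o0 -> P o1 -> P o2 -> forall i, P i.
Proof.
move=> P0 P1 P2 [[|[|[|//]]] lti].
- by rewrite (_ : Ordinal _ = o0)//; exact: val_inj.
- by rewrite (_ : Ordinal _ = o1)//; exact: val_inj.
- by rewrite (_ : Ordinal _ = o2)//; exact: val_inj.
Qed.

Lemma matrix3P (T : Type) (M N : 'M[T]_3) :
  M o0 o0 = N o0 o0 -> M o0 o1 = N o0 o1 -> M o0 o2 = N o0 o2 ->
  M o1 o0 = N o1 o0 -> M o1 o1 = N o1 o1 -> M o1 o2 = N o1 o2 ->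
  M o2 o0 = N o2 o0 -> M o2 o1 = N o2 o1 -> M o2 o2 = N o2 o2 -> M = N.
Proof.
by move=> *; apply/matrixP; apply: forall_I3; apply: forall_I3.
Qed.

(** * Quaternion arithmetic *)

Section Quaternions.
Variable R : realType.
Local Notation H := (quat R).

Lemma quatM (a b c d a' b' c' d' : R) : Quat a b c d * Quat a' b' c' d' =
  Quat (a * a' - b * b' - c * c' - d * d') (a * b' + b * a' + c * d' - d * c')
    (a * c' - b * d' + c * a' + d * b') (a * d' + b * c' - c * b' + d * a').
Proof. by []. Qed.

Lemma quatD (a b c d a' b' c' d' : R) : Quat a b c d + Quat a' b' c' d' =
  Quat (a + a') (b + b') (c + c') (d + d').
Proof. by []. Qed.

Lemma quatN (a b c d : R) : - Quat a b c d = Quat (- a) (- b) (- c) (- d).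
Proof. by []. Qed.

Lemma quat_star (a b c d : R) :
  star (Quat a b c d) = Quat a (- b) (- c) (- d).
Proof. by []. Qed.

Definition quatE := (quat_star, quatM, quatD, quatN).

Lemma quat_eq0 (a b c d : R) : a = 0 -> b = 0 -> c = 0 -> d = 0 ->
  Quat a b c d = 0.
Proof. by move=> -> -> -> ->. Qed.

(** The real coordinates are additive, so an identity that is linear in
    products of quaternions follows from real linear arithmetic once it is read
    through an arbitrary additive [f], the products being kept as atoms. *)
Lemma quat_additiveP (p q : H) :
  (forall f : H -> R, f 0 = 0 -> {morph f : x y / x + y >-> x + y} ->
    {morph f : x / - x >-> - x} -> f p = f q) -> p = q.
Proof.
move=> E; have := E (@qre R); have := E (@qi R); have := E (@qj R).
have := E (@qk R); case: p q {E} => [a b c d] [a' b' c' d'] /= Ek Ej Ei Er.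
by rewrite Ek// Ej// Ei// Er.
Qed.

End Quaternions.

(** * Centralizers of order 3 matrices *)

Section OrderThree.
Variable R : realType.
Local Notation H := (quat R).
Implicit Types (x w : H) (M : 'M[H]_3).

Definition rows3 (s : seq (seq H)) : 'M[H]_3 :=
  \matrix_(i, j) nth 0 (nth [::] s i) j.

Definition order3 x := rows3
  [:: [:: 1; x; -1]; [:: - star x; -1; 0]; [:: -1; 0; 0]].

Definition heis w := rows3 [:: [:: 1; 0; w]; [:: 0; 1; 0]; [:: 0; 0; 1]].

Let entries := (mxE, big_ord_recl, big_ord0).
Let units := (@mul0r H, @mulr0 H, @mul1r H, @mulr1 H, @add0r H, @addr0 H,
  @mulN1r H, @mulrN1 H, @oppr0 H, @mulNr H, @mulrN H, @opprK H,
  @mulr0n H, @mulr1n H).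

Lemma heisD v w : heis v *m heis w = heis (v + w).
Proof. by apply: matrix3P; rewrite !entries /= !units // addrC. Qed.

Lemma heis0 : heis 0 = 1%:M.
Proof. by apply: matrix3P; rewrite !entries. Qed.

Lemma heis_preserves_J21 w : star w = - w -> preserves_J21 (heis w).
Proof.
move=> sw; apply/asboolP; split.
  by exists (heis (- w)); rewrite !heisD subrr addNr heis0.
by apply: matrix3P;
  rewrite !entries /= ?sw ?star0 ?star1 !units // ?subrr ?addNr.
Qed.

Lemma heis_conj w M : heis (- w) *m M *m heis w = rows3
  [:: [:: M o0 o0 - w * M o2 o0; M o0 o1 - w * M o2 o1;
          (M o0 o0 - w * M o2 o0) * w + (M o0 o2 - w * M o2 o2)];
      [:: M o1 o0; M o1 o1; M o1 o0 * w + M o1 o2];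
      [:: M o2 o0; M o2 o1; M o2 o0 * w + M o2 o2]].
Proof.
have -> : heis (- w) *m M = rows3
    [:: [:: M o0 o0 - w * M o2 o0; M o0 o1 - w * M o2 o1;
            M o0 o2 - w * M o2 o2];
        [:: M o1 o0; M o1 o1; M o1 o2]; [:: M o2 o0; M o2 o1; M o2 o2]].
  by apply: matrix3P; rewrite !entries /= !units.
by apply: matrix3P; rewrite !entries /= !units.
Qed.

Lemma order3_cubed x : x * star x = 2 -> star x * x = 2 ->
  order3 x *m (order3 x *m order3 x) = 1%:M.
Proof.
move=> xx' x'x.
have two : 2 = 1 + 1 :> H by [].
have -> : order3 x *m order3 x =
    rows3 [:: [:: 0; 0; -1]; [:: 0; -1; star x]; [:: -1; - x; 1]].
  by apply: matrix3P; rewrite !entries /= !units // ?xx' ?x'x;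
    apply: quat_additiveP => f f0 fD fN; rewrite ?two !(fD, fN, f0); lra.
by apply: matrix3P; rewrite !entries /= !units // ?xx' ?x'x;
  apply: quat_additiveP => f f0 fD fN; rewrite ?two !(fD, fN, f0); lra.
Qed.

(** [e_3] is a cyclic vector of [order3 x], so commuting matrices are determined
    by their last column, and dually by their last row. *)
Lemma order3_centralizer x M : M *m order3 x = order3 x *m M ->
  [/\ M o0 o0 = M o2 o2 - M o2 o0 + M o2 o1 * star x,
      M o0 o1 = M o2 o1 - M o2 o0 * x
    & M o0 o2 = M o2 o0] /\
  [/\ M o0 o0 = M o2 o2 - M o2 o0 - x * M o1 o2,
      M o1 o0 = star x * M o0 o2 + M o1 o2
    & M o0 o0 * x - M o0 o1 = M o0 o1 + x * M o1 o1 - M o2 o1].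
Proof.
move=> /matrixP MS.
have := MS o2 o0; have := MS o2 o1; have := MS o2 o2; have := MS o0 o2.
have := MS o1 o2; have := MS o0 o1.
rewrite !entries /= !units => e01 e12 e02 e22 e21 e20.
by split; split; apply: quat_additiveP => f f0 fD fN;
  move: (congr1 f e01) (congr1 f e12)
  (congr1 f e02) (congr1 f e22) (congr1 f e21) (congr1 f e20);
  rewrite !(fD, fN, f0); lra.
Qed.

Section Twist.
Variables u v t : R.
Let x : H := Quat u v 0 0.
Let w : H := Quat 0 0 t 0.
Hypotheses (u0 : u != 0) (v0 : v != 0) (t0 : t != 0).

(** The step where [t] must be small. Since [x + star x = 2 u] is real, the
    equations split into coordinates: the [i] and [k] components of [a] and [b]
    vanish directly, while the real and [j] components of [a] are only
    annihilated by [t ^ 2 - 2 u ^ 2]. *)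
Lemma twist_vanish (a b : H) : t ^+ 2 != 2 * u ^+ 2 ->
  w * b = - (a * x + a * star x) -> b * x + b * star x = a * w + w * a ->
  a = 0 /\ b = 0.
Proof.
move=> tu; rewrite /x /w; case: a b => [a0 a1 a2 a3] [b0 b1 b2 b3].
rewrite !quatE => -[e0 e1 e2 e3] [f0 f1 f2 f3].
have b1E : b1 = 0 by apply: (mulfI u0); lra.
have b3E : b3 = 0 by apply: (mulfI u0); lra.
have a1E : a1 = 0 by apply: (mulfI u0); rewrite b3E in e1; lra.
have a3E : a3 = 0 by apply: (mulfI u0); rewrite b1E in e3; lra.
have g0 : t * b2 = 2 * u * a0 by lra.
have g2 : t * b0 = - (2 * u * a2) by lra.
have h0 : u * b2 = t * a0 by lra.
have h2 : u * b0 = - (t * a2) by lra.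
have D : t ^+ 2 - 2 * u ^+ 2 != 0 by rewrite subr_eq0.
have a0E : a0 = 0.
  apply: (mulfI D); rewrite mulr0.
  have -> : (t ^+ 2 - 2 * u ^+ 2) * a0 = t * (t * a0) - u * (2 * u * a0) by ring.
  by rewrite -g0 -h0; ring.
have a2E : a2 = 0.
  apply: (mulfI D); rewrite mulr0.
  have -> : (t ^+ 2 - 2 * u ^+ 2) * a2 =
    u * (- (2 * u * a2)) - t * (- (t * a2)) by ring.
  by rewrite -g2 -h2; ring.
split; apply: quat_eq0 => //; apply: (mulfI u0); rewrite mulr0.
  by rewrite h2 a2E mulr0 oppr0.
by rewrite h0 a0E mulr0.
Qed.

Lemma twist_real (c e : H) :
  c * x = x * e -> c * star x = star x * e -> c * w = w * c ->
  c = e /\ c = Quat (qre c) 0 0 0.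
Proof.
rewrite /x /w; case: c e => [c0 c1 c2 c3] [e0 e1 e2 e3].
rewrite !quatE => -[p0 p1 p2 p3] [q0 q1 q2 q3] [r0 r1 r2 r3] /=.
have E0 : c0 = e0 by apply: (mulfI u0); lra.
have E1 : c1 = e1 by apply: (mulfI u0); lra.
have E2 : c2 = e2 by apply: (mulfI u0); lra.
have E3 : c3 = e3 by apply: (mulfI u0); lra.
subst; split=> //.
have -> : e1 = 0 by apply: (mulfI t0); lra.
have -> : e2 = 0 by apply: (mulfI v0); lra.
by have -> : e3 = 0 by apply: (mulfI v0); lra.
Qed.

Lemma quat_mul_eq0 (d : H) : x * d = 0 -> d = 0.
Proof.
move=> xd; have : star x * (x * d) = 0 by rewrite xd mulr0.
have N : u ^+ 2 + v ^+ 2 != 0.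
  by rewrite gt_eqF// ltr_pwDl ?sqr_ge0// exprn_even_gt0.
rewrite mulrA /x; case: d {xd} => [d0 d1 d2 d3]; rewrite !quatE => -[e0 e1 e2 e3].
by apply: quat_eq0; apply: (mulfI N); lra.
Qed.

(** The second generator is [heis w *m order3 (- star x) *m heis (- w)].
    Conjugating the commutation with it back by [heis w] makes
    [order3_centralizer] applicable to both hypotheses; the last row of
    [heis (- w) *m M *m heis w] differs from that of [M] in its last entry
    only. *)
Lemma twisted_centralizer M : t ^+ 2 != 2 * u ^+ 2 ->
  M *m order3 x = order3 x *m M ->
  (heis (- w) *m M *m heis w) *m order3 (- star x) =
    order3 (- star x) *m (heis (- w) *m M *m heis w) ->
  exists s, M = (Quat s 0 0 0)%:M.
Proof.
move=> tu cA cB.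
have [[m00 m01 m02] [d00 m10 e11]] := order3_centralizer cA.
move: cB; rewrite heis_conj => /order3_centralizer.
rewrite ![rows3 _ _ _]mxE /= => -[[n00 n01 n02] [_ _ f11]].
have sx : star (- star x) = - x by rewrite /x !quatE !oppr0 !opprK.
have [a0 b0] : M o2 o0 = 0 /\ M o2 o1 = 0.
  apply: twist_vanish => //.
    apply: quat_additiveP => f f0 fD fN; move: (congr1 f m01) (congr1 f n01).
    by rewrite mulrN !(fD, fN); lra.
  apply: quat_additiveP => f f0 fD fN; move: (congr1 f m00) (congr1 f n00).
  by rewrite sx mulrN !(fD, fN); lra.
rewrite a0 b0 in m00 m01 m02 d00 m10 e11 n00 n01 n02 f11.
rewrite !(mul0r, mulr0, oppr0, addr0, add0r) in m00 m01 m02 d00.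
have d0 : M o1 o2 = 0.
  apply: quat_mul_eq0; apply: quat_additiveP => f f0 fD fN.
  by move: (congr1 f d00); rewrite m00 !(fD, fN, f0); lra.
rewrite m00 m01 m02 d0 ?(mul0r, mulr0, oppr0, addr0, add0r) in m10 e11 n02 f11.
have [ce cs] : M o2 o2 = M o1 o1 /\ M o2 o2 = Quat (qre (M o2 o2)) 0 0 0.
  apply: twist_real => //.
    apply: quat_additiveP => f f0 fD fN; move: (congr1 f f11).
    by rewrite mulrN mulNr !(fD, fN, f0); lra.
  by apply/eqP; rewrite -subr_eq0 n02.
exists (qre (M o2 o2)); rewrite -cs.
by apply: matrix3P; rewrite [RHS]mxE /= ?(mulr0n, mulr1n) // m00.
Qed.

End Twist.

End OrderThree.

(** * Conjugacy into U(2,1) and the relator *)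

Lemma scalar_mx_comm (A : nzRingType) n (c : A) (M : 'M[A]_n) :
  (forall i j, c * M i j = M i j * c) -> c%:M *m M = M *m c%:M.
Proof.
move=> cM; rewrite mul_scalar_mx; apply/matrixP => i j.
rewrite !mxE (bigD1 j)//= mxE eqxx mulr1n big1 ?addr0// => k kj.
by rewrite mxE (negbTE kj) mulr0.
Qed.

Lemma conjmx_sqrN1 (A : nzRingType) n (g g' I : 'M[A]_n) :
  g *m g' = 1%:M -> g' *m g = 1%:M -> I *m I = - 1%:M ->
  (g' *m I *m g) *m (g' *m I *m g) = - 1%:M.
Proof.
move=> gg' g'g II.
rewrite -[LHS]mulmxA (mulmxA g) (mulmxA g g') gg' mul1mx (mulmxA _ I g).
by rewrite -(mulmxA g' I I) II mulmxN mulmx1 mulNmx g'g.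
Qed.

Lemma conjmx_comm (A : nzRingType) n (g g' I X : 'M[A]_n) :
  g *m g' = 1%:M -> g' *m g = 1%:M ->
  I *m (g *m X *m g') = g *m X *m g' *m I ->
  (g' *m I *m g) *m X = X *m (g' *m I *m g).
Proof.
move=> gg' g'g IX; rewrite -[in LHS](mulmx1 X) -g'g -[LHS]mulmxA (mulmxA X).
rewrite (mulmxA g) (mulmxA g X) (mulmxA (g' *m I)) -(mulmxA g' I) IX.
by rewrite !mulmxA g'g mul1mx.
Qed.

(** The witness is [g^-1 i g]: the scalar matrix [i] commutes with complex
    matrices, though not with all quaternionic ones. *)
Lemma conj_into_U21 (R : realType) (rho : Hom_W_Sp R) (g : Sp21 R) :
  (forall x, exists u : U21 R, (g * rho x * g^-1)%g = Sp_of_U u) ->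
  exists M : 'M[quat R]_3, M *m M = - 1%:M /\
    forall x, M *m U21_val (rho x) = U21_val (rho x) *m M.
Proof.
move=> gU; pose I : 'M[quat R]_3 := (Quat 0 1 0 0)%:M.
have g'g : U21_val g^-1%g *m U21_val g = 1%:M.
  by rewrite -[LHS]/(U21_val (g^-1 * g)%g) mulVg.
have gg' : U21_val g *m U21_val g^-1%g = 1%:M.
  by rewrite -[LHS]/(U21_val (g * g^-1)%g) mulgV.
have II : I *m I = - 1%:M.
  rewrite /I -scalar_mxM -raddfN quatM; congr (_%:M).
  by rewrite -[RHS]/(Quat (-1) (-0) (-0) (-0)); congr Quat; ring.
exists (U21_val g^-1%g *m I *m U21_val g); split; first exact: conjmx_sqrN1.
move=> x; apply: conjmx_comm => //.
have [u gu] := gU x.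
rewrite -[_ *m U21_val (rho x) *m _]/(U21_val (g * rho x * g^-1)%g) gu.
apply: scalar_mx_comm => i j; rewrite /= mxE; case: (U21_val u i j) => a b.
by rewrite /complex_quat /= !quatE; congr Quat; ring.
Qed.

(** After cancelling [b b ^ 2] and the cubes of [a], the relator becomes
    [a a^-1 b^-3]. *)
Lemma relator_W_order3 (G : groupType) (f : 'I_2 -> G) :
  (forall i, f i * (f i * f i) = 1)%g -> word_val f relator_W = 1%g.
Proof.
move=> f3; rewrite /word_val /relator_W /= !big_cons big_nil /letter_val /=.
set a := f _; set b := f _.
have [a3 b3] : (a * (a * a) = 1 /\ b * (b * b) = 1)%g by split; exact: f3.
have cubeK (c d : G) : (c * (c * c) = 1 -> c * (c * (c * d)) = d)%g.
  by move=> c3; rewrite !mulgA -[(c * c * c)%g]mulgA c3 mul1g.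
have aV3 : (a^-1 * (a^-1 * a^-1) = 1)%g by rewrite -!invgM -mulgA a3 invg1.
have bV3 : (b^-1 * (b^-1 * b^-1) = 1)%g by rewrite -!invgM -mulgA b3 invg1.
by rewrite mulg1 cubeK// cubeK// (cubeK a)// bV3 mulg1 mulgV.
Qed.

(** * Convergence of quaternions and quaternionic matrices *)

Section Topology.
Local Open Scope classical_set_scope.

Lemma cvg_initial (S : choiceType) (T : topologicalType) (f : S -> T)
    (F : set_system S) (s : initial_topology f) :
  Filter F -> f @ F --> f s -> F --> s.
Proof.
move=> FF Ff B [_ [[C Copen <-] Cs] CB].
by apply: filterS CB _; apply: Ff; exact: open_nbhs_nbhs.
Qed.

Variable R : realType.
Local Notation H := (quat R).
Context {T : Type} {F : set_system T} {FF : Filter F}.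

Lemma cvg_quat (f : T -> H) (p : H) :
  qre (f t) @[t --> F] --> qre p -> qi (f t) @[t --> F] --> qi p ->
  qj (f t) @[t --> F] --> qj p -> qk (f t) @[t --> F] --> qk p ->
  f t @[t --> F] --> p.
Proof.
move=> cr ci cj ck; apply: cvg_initial.
exact: (cvg_pair (cvg_pair (cvg_pair cr ci) cj) ck).
Qed.

Lemma quat_cvg (f : T -> H) (p : H) : f t @[t --> F] --> p ->
  [/\ qre (f t) @[t --> F] --> qre p, qi (f t) @[t --> F] --> qi p,
      qj (f t) @[t --> F] --> qj p & qk (f t) @[t --> F] --> qk p].
Proof.
move=> cf.
have cc : quat_coords (f t) @[t --> F] --> quat_coords p.
  by apply: cvg_comp cf _; exact: (@initial_continuous _ _ (@quat_coords R)).
split.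
- exact: (cvg_comp _ _ cc (cvg_comp _ _ cvg_fst (cvg_comp _ _ cvg_fst cvg_fst))).
- exact: (cvg_comp _ _ cc (cvg_comp _ _ cvg_fst (cvg_comp _ _ cvg_fst cvg_snd))).
- exact: (cvg_comp _ _ cc (cvg_comp _ _ cvg_fst cvg_snd)).
- exact: (cvg_comp _ _ cc cvg_snd).
Qed.

Lemma cvg_quatD (f g : T -> H) (p q : H) :
  f t @[t --> F] --> p -> g t @[t --> F] --> q ->
  f t + g t @[t --> F] --> p + q.
Proof.
move=> /quat_cvg[f0 f1 f2 f3] /quat_cvg[g0 g1 g2 g3].
by apply: cvg_quat; exact: cvgD.
Qed.

Lemma cvg_quatM (f g : T -> H) (p q : H) :
  f t @[t --> F] --> p -> g t @[t --> F] --> q ->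
  f t * g t @[t --> F] --> p * q.
Proof.
move=> /quat_cvg[f0 f1 f2 f3] /quat_cvg[g0 g1 g2 g3].
apply: cvg_quat.
- exact: cvgB (cvgB (cvgB (cvgM f0 g0) (cvgM f1 g1)) (cvgM f2 g2)) (cvgM f3 g3).
- exact: cvgB (cvgD (cvgD (cvgM f0 g1) (cvgM f1 g0)) (cvgM f2 g3)) (cvgM f3 g2).
- exact: cvgD (cvgD (cvgB (cvgM f0 g2) (cvgM f1 g3)) (cvgM f2 g0)) (cvgM f3 g1).
- exact: cvgD (cvgB (cvgD (cvgM f0 g3) (cvgM f1 g2)) (cvgM f2 g1)) (cvgM f3 g0).
Qed.

Lemma cvg_mx (m n : nat) (f : T -> 'M[H]_(m, n)) (M : 'M[H]_(m, n)) :
  (forall i j, f t i j @[t --> F] --> M i j) -> f t @[t --> F] --> M.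
Proof.
move=> cf B [P MP PB]; apply: (filterS PB).
apply: filter_forall => i; apply: filter_forall => j.
exact: (cf i j _ (MP i j)).
Qed.

(** Stated on entries so that it can be iterated before [cvg_mx] returns to the
    topology of matrices. *)
Lemma cvg_mulmx_entries (m n p : nat) (f : T -> 'M[H]_(m, n))
    (g : T -> 'M[H]_(n, p)) (M : 'M[H]_(m, n)) (N : 'M[H]_(n, p)) :
  (forall i j, f t i j @[t --> F] --> M i j) ->
  (forall i j, g t i j @[t --> F] --> N i j) ->
  forall i j, (f t *m g t) i j @[t --> F] --> (M *m N) i j.
Proof.
move=> fM gN i j; rewrite !mxE; under eq_fun do rewrite !mxE.
elim: (index_enum _) => [|k s IH].
  by rewrite big_nil; under eq_fun do rewrite big_nil; exact: cvg_cst.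
rewrite big_cons; under [X in X @ F]eq_fun do rewrite big_cons.
by apply: cvg_quatD => //; exact: cvg_quatM.
Qed.

End Topology.

(** * The deformation *)

Section Deformation.
Variable R : realType.
Local Notation H := (quat R).
Local Open Scope classical_set_scope.

Lemma complex_quat_half (z : R[i]) (a b : R) :
  z = (a%:C%C + imI R * b%:C%C) / 2 ->
  complex_quat z = Quat (a / 2) (b / 2) 0 0.
Proof.
have half : (2 : R[i])^-1 = (2^-1)%:C%C by rewrite fmorphV rmorph_nat.
move=> ->; rewrite half complex_quatM complex_quatD complex_quatM.
by rewrite /complex_quat /imI /= !quatE /=; congr Quat; ring.
Qed.

Definition x_W : H := Quat (Num.sqrt 3 / 2) (- Num.sqrt 5 / 2) 0 0.

Lemma complex_quatN1 : complex_quat (-1 : R[i]) = -1.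
Proof.
by rewrite /complex_quat -[RHS]/(Quat (-1) (-0) (-0) (-0)) oppr0 /= oppr0.
Qed.

Lemma quatmx_mx_a : quatmx (mx_a R) = order3 x_W.
Proof.
apply: matrix3P; rewrite !mxE //= ?complex_quatN1 //.
- rewrite (@complex_quat_half _ (Num.sqrt 3) (- Num.sqrt 5)) //.
  by rewrite rmorphN mulrN.
- rewrite (@complex_quat_half _ (- Num.sqrt 3) (- Num.sqrt 5)).
    by rewrite /x_W !quatE /=; congr Quat; ring.
  by rewrite !rmorphN mulrN.
Qed.

Lemma quatmx_mx_b : quatmx (mx_b R) = order3 (- star x_W).
Proof.
apply: matrix3P; rewrite !mxE //= ?complex_quatN1 //.
- rewrite (@complex_quat_half _ (- Num.sqrt 3) (- Num.sqrt 5)).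
    by rewrite /x_W !quatE /=; congr Quat; ring.
  by rewrite !rmorphN -mulNr opprD mulrN.
- rewrite (@complex_quat_half _ (Num.sqrt 3) (- Num.sqrt 5)).
    by rewrite /x_W !quatE /=; congr Quat; ring.
  by rewrite rmorphN mulrN.
Qed.

Lemma x_W_norm : x_W * star x_W = 2 /\ star x_W * x_W = 2.
Proof.
have -> : 2 = Quat 2 0 0 0 :> H.
  by rewrite -[LHS]/(Quat 1 0 0 0 + Quat 1 0 0 0) quatD !addr0.
have s3 : Num.sqrt 3 ^+ 2 = 3 :> R by rewrite sqr_sqrtr// ler0n.
have s5 : Num.sqrt 5 ^+ 2 = 5 :> R by rewrite sqr_sqrtr// ler0n.
by split; rewrite /x_W !quatE /=; congr Quat; lra.
Qed.

(** The direction [j] anticommutes with [i], so [heis (t j)] is not complex and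
    only real quaternions commute with both [j] and [x_W]. *)
Definition twist_quat (t : R) : H := Quat 0 0 t 0.

Lemma twist_quatN t : twist_quat (- t) = - twist_quat t.
Proof. by rewrite /twist_quat quatN oppr0. Qed.

Lemma twist_quat_star t : star (twist_quat t) = - twist_quat t.
Proof. by rewrite /twist_quat quatE -[RHS]/(Quat (- 0) (- 0) (- t) (- 0)) oppr0. Qed.

Definition twist (t : R) : Sp21 R :=
  U21_Of (heis_preserves_J21 (twist_quat_star t)).

Lemma twistV t : U21_val (twist t)^-1%g = heis (- twist_quat t).
Proof.
rewrite -[LHS]mulmx1 -(@heis0 R) -(subrr (twist_quat t)) -heisD mulmxA.
by rewrite -[X in X *m _]/(U21_val ((twist t)^-1 * twist t)%g) mulVg mul1mx.
Qed.

Definition Sp_a : Sp21 R := Sp_of_U (SU21_val (SU_a R)).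
Definition Sp_b : Sp21 R := Sp_of_U (SU21_val (SU_b R)).

Lemma Sp_aE : U21_val Sp_a = order3 x_W.
Proof. exact: quatmx_mx_a. Qed.
Lemma Sp_bE : U21_val Sp_b = order3 (- star x_W).
Proof. exact: quatmx_mx_b. Qed.

Lemma Sp_a3 : (Sp_a * (Sp_a * Sp_a) = 1)%g.
Proof.
have [xx' x'x] := x_W_norm.
apply: val_inj; rewrite -[LHS]/(U21_val Sp_a *m (U21_val Sp_a *m U21_val Sp_a)).
by rewrite Sp_aE order3_cubed.
Qed.

Lemma Sp_b3 : (Sp_b * (Sp_b * Sp_b) = 1)%g.
Proof.
have [xx' x'x] := x_W_norm.
apply: val_inj; rewrite -[LHS]/(U21_val Sp_b *m (U21_val Sp_b *m U21_val Sp_b)).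
have sx : star (- star x_W) = - x_W.
  by rewrite /x_W !quatE /=; congr Quat; ring.
by rewrite Sp_bE order3_cubed// sx mulrNN.
Qed.

Definition deformed_gen (t : R) (i : 'I_2) : Sp21 R :=
  if i == ord0 then Sp_a else (twist t * Sp_b * (twist t)^-1)%g.

Lemma deformed_gen_relator t :
  {in [:: relator_W], forall r, word_val (deformed_gen t) r = 1%g}.
Proof.
move=> r; rewrite inE => /eqP ->; apply: relator_W_order3 => i.
rewrite /deformed_gen; case: ifP => _; first exact: Sp_a3.
by rewrite !mulgA !mulgVK -(mulgA (twist t)) -(mulgA (twist t)) -(mulgA Sp_b)
  Sp_b3 mulg1 mulgV.
Qed.

Definition deformation (t : R) : Hom_W_Sp R := pres_hom (deformed_gen_relator t).

Lemma deformation_a t : deformation t gen_a = Sp_a.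
Proof. by rewrite [LHS]pres_lift_gen//; exact: deformed_gen_relator. Qed.

Lemma deformation_b t :
  deformation t gen_b = (twist t * Sp_b * (twist t)^-1)%g.
Proof. by rewrite [LHS]pres_lift_gen//; exact: deformed_gen_relator. Qed.

Lemma rho_W_Sp_a : rho_W_Sp R gen_a = Sp_a.
Proof. by apply: val_inj; rewrite -[LHS]/(quatmx (SU21_val (rho_W R gen_a))) rho_W_a. Qed.

Lemma rho_W_Sp_b : rho_W_Sp R gen_b = Sp_b.
Proof. by apply: val_inj; rewrite -[LHS]/(quatmx (SU21_val (rho_W R gen_b))) rho_W_b. Qed.

Lemma cvg_heis_entries (T : Type) (F : set_system T) (w : T -> H) :
  Filter F -> w t @[t --> F] --> (0 : H) ->
  forall i j, heis (w t) i j @[t --> F] --> (1%:M : 'M[H]_3) i j.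
Proof.
move=> FF w0; apply: forall_I3; apply: forall_I3; rewrite !mxE /=;
  under eq_fun do rewrite mxE /=; by [exact: w0 | exact: cvg_cst].
Qed.

Lemma cvg_twist_quat (T : Type) (F : set_system T) (u : T -> R) :
  Filter F -> u t @[t --> F] --> (0 : R) ->
  twist_quat (u t) @[t --> F] --> (0 : H).
Proof. by move=> FF u0; apply: cvg_quat => //=; exact: cvg_cst. Qed.

Lemma cvg_deformation : deformation t @[t --> 0^'+] --> rho_W_Sp R.
Proof.
apply: cvg_initial; rewrite [X in _ --> X]/gen_images rho_W_Sp_a rho_W_Sp_b.
suff cb : (twist t * Sp_b * (twist t)^-1)%g @[t --> (0 : R)^'+] --> Sp_b.
  have genE : (fun t => gen_images (deformation t)) =
      (fun t => (Sp_a, (twist t * Sp_b * (twist t)^-1)%g)).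
    by apply/funext => t; rewrite /gen_images deformation_a deformation_b.
  rewrite -[X in X --> _]/((fun t => gen_images (deformation t)) @ (0 : R)^'+).
  by rewrite genE; exact: (cvg_pair (cvg_cst _) cb).
apply: cvg_initial.
have pathE : (fun t => U21_val (twist t * Sp_b * (twist t)^-1)%g) =
    (fun t => heis (twist_quat t) *m U21_val Sp_b *m heis (twist_quat (- t))).
  by apply/funext => t; rewrite twist_quatN -twistV.
rewrite -[X in X --> _]/((fun t => U21_val (twist t * Sp_b * (twist t)^-1)%g) @
  (0 : R)^'+) pathE.
have SbE : 1%:M *m U21_val Sp_b *m 1%:M = U21_val Sp_b.
  by rewrite mul1mx mulmx1.
rewrite -[X in _ --> X]SbE.
have t0 : t @[t --> (0 : R)^'+] --> (0 : R) by exact: cvg_within.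
have tN : - t @[t --> (0 : R)^'+] --> (0 : R).
  by rewrite -[X in _ --> X]oppr0; exact: cvgN.
apply: cvg_mx; apply: cvg_mulmx_entries; last first.
  by apply: cvg_heis_entries; apply: cvg_twist_quat; exact: tN.
apply: cvg_mulmx_entries => [|? ?]; last exact: cvg_cst.
by apply: cvg_heis_entries; exact: cvg_twist_quat.
Qed.

(** A matrix commuting with the deformed representation is a real scalar, so its
    square is not [-1]. The bound on [t] ensures [2 t ^ 2 < 3]. *)
Lemma deformation_not_U21 (t : R) : 0 < t < 1 -> forall g : Sp21 R,
  ~ (forall x : Gamma_W, exists u : U21 R,
       (g * deformation t x * g^-1)%g = Sp_of_U u).
Proof.
move=> /andP[t0 t1] g /conj_into_U21[M [MM Mrho]].
have Ma : M *m order3 x_W = order3 x_W *m M.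
  by have := Mrho gen_a; rewrite deformation_a Sp_aE.
have Mb : heis (- twist_quat t) *m M *m heis (twist_quat t) *m
      order3 (- star x_W) =
    order3 (- star x_W) *m
      (heis (- twist_quat t) *m M *m heis (twist_quat t)).
  apply: conjmx_comm; [by rewrite heisD subrr heis0|by rewrite heisD addNr heis0|].
  by have := Mrho gen_b; rewrite deformation_b -twistV -Sp_bE.
have t2 : t ^+ 2 < 1 by rewrite expr_lt1// ltW.
have s3 : Num.sqrt 3 ^+ 2 = 3 :> R by rewrite sqr_sqrtr// ler0n.
have [||||s Ms] := twisted_centralizer _ _ _ _ Ma Mb.
- by rewrite mulf_neq0 ?invr_eq0 ?pnatr_eq0// gt_eqF// sqrtr_gt0 ltr0n.
- by rewrite mulf_neq0 ?invr_eq0 ?pnatr_eq0// oppr_eq0 gt_eqF// sqrtr_gt0 ltr0n.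
- exact: lt0r_neq0.
- by rewrite lt_eqF//; lra.
have /(congr1 (fun N : 'M[H]_3 => qre (N ord0 ord0))) := MM.
rewrite Ms -scalar_mxM quatM !mxE /= => ss.
by have := sqr_ge0 s; rewrite expr2; lra.
Qed.

Lemma deformation_in_nbhs (U : set (Hom_W_Sp R)) : nbhs (rho_W_Sp R) U ->
  exists2 t : R, 0 < t < 1 & U (deformation t).
Proof.
move=> UW; have /filter_ex[t [t01 Ut]] :
    \forall t \near (0 : R)^'+, 0 < t < 1 /\ U (deformation t).
  near=> t; split; first by apply/andP; split.
  by near: t; exact: cvg_deformation UW.
by exists t.
Unshelve. all: by end_near. Qed.

End Deformation.

Theorem proposition2p2 (R : realType) (U : set (Hom_W_Sp R))
  (rho_W_U : nbhs (rho_W_Sp R) U) :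
  exists rho : Hom_W_Sp R, U rho /\
    forall g : Sp21 R,
      ~ (forall x : Gamma_W, exists u : U21 R,
           (g * rho x * g^-1)%g = Sp_of_U u).
Proof.
have [t t01 Ut] := deformation_in_nbhs rho_W_U.
by exists (deformation t); split=> //; exact: deformation_not_U21.
Qed.
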